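(* There are functions $A_N:\mathbb{R}^N\to\mathbb{C}$ ($N\ge1$) such that, for every lattice site $\ell\in\mathbb{Z}$, every $N\ge1$, all $u_1,\dots,u_N\in\mathcal{G}_{\mathrm{poly}}$ and all $F_1,\dots,F_N\in\mathbb{R}$ with $u_j[\ell]=e^{iF_j}$, the sum $S_N=\sum_{j=1}^N e^{iF_j}$ factors as $$S_N(F_1,\dots,F_N)=A_N(F_1,\dots,F_N)\,\exp\Bigl(i\,\frac1N\sum_{j=1}^N F_j\Bigr),$$ where $A_1=1$, $A_2(F_1,F_2)=2\cos\bigl(\tfrac{F_1-F_2}{2}\bigr)$, and for all $N\ge1$ and all such phases $F_1,\dots,F_{N+1}$, $$\bigl(A_{N+1}(F_1,\dots,F_{N+1})\bigr)^{N+1}=\prod_{m=1}^{N+1}\left(A_{N,m}+\exp\Bigl(-i\,\frac{\sum_{j\ne m}F_j-NF_m}{N}\Bigr)\right),$$ where $A_{N,m}=A_N(F_1,\dots,\widehat{F_m},\dots,F_{N+1})$ is $A_N$ evaluated at the $N$ phases obtained by omitting $F_m$ (and sums over $j\neq m$ run over $j\in\{1,\dots,N+1\}\setminus\{m\}$).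
   Context: $\mathcal{G}_{\mathrm{poly}}$ is the group of polynomial-phase wave sequences: the sequences $u:\mathbb{Z}\to\mathbb{C}$ obtained as $u[m]=\exp(2\pi i\theta[m])$, where $\theta$ ranges over the smallest set of functions $\mathbb{Z}\to\mathbb{R}$ containing $m\mapsto 1$ and $m\mapsto m^k$ for all $k\ge1$ and closed under pointwise addition, negation, and the root operations $\theta\mapsto(\theta+j)/n$ for all integers $n\ge1$, $j\in\{0,\dots,n-1\}$. Equivalently, $u[m]=\exp(2\pi iP(m))$ with $P\in\mathbb{Q}[X]$. *)

(* Defs.v *)
From mathcomp Require Import all_boot all_order all_algebra.
From mathcomp Require Import complex.
From mathcomp Require Import reals topology normedtype sequences exp trigo.

Set Implicit Arguments.
Unset Strict Implicit.
Unset Printing Implicit Defensive.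

Import Order.TTheory GRing.Theory Num.Theory.
Local Open Scope ring_scope.
Local Open Scope complex_scope.

(* exp (x + i y) = e^x (cos y + i sin y) *)
Definition cexp (R : realType) (z : R[i]) : R[i] :=
  (expR (complex.Re z))%:C
    * (cos (complex.Im z) +i* sin (complex.Im z)).

Inductive poly_phase (R : realType) : (int -> R) -> Prop :=
| PolyPhase1 : poly_phase (fun _ : int => 1)
| PolyPhaseX (k : nat) : (1 <= k)%N -> poly_phase (fun m : int => m%:~R ^+ k)
| PolyPhaseD (t1 t2 : int -> R) :
    poly_phase t1 -> poly_phase t2 -> poly_phase (fun m : int => t1 m + t2 m)
| PolyPhaseN (t : int -> R) :
    poly_phase t -> poly_phase (fun m : int => - t m)
| PolyPhaseRoot (t : int -> R) (n j : nat) :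
    (1 <= n)%N -> (j < n)%N -> poly_phase t ->
    poly_phase (fun m : int => (t m + j%:R) / n%:R).

Definition Gpoly (R : realType) (u : int -> R[i]) : Prop :=
  exists2 t : int -> R, poly_phase t &
    forall m : int, u m = cexp (2 * pi%:C * 'i%C * (t m)%:C).

(* Main.v *)
Require Import Defs.
From mathcomp Require Import all_boot all_order all_algebra.
From mathcomp Require Import complex.
From mathcomp Require Import reals topology normedtype sequences exp trigo.
From mathcomp Require Import ring.

Set Implicit Arguments.
Unset Strict Implicit.
Unset Printing Implicit Defensive.

Import Order.TTheory GRing.Theory Num.Theory.
Local Open Scope ring_scope.
Local Open Scope complex_scope.

(** The amplitude is the sum with its mean phase removed,
    [A_N F = \sum_j exp (i (F_j - mean F))], which gives the factorisation
    [S_N = A_N * exp (i * mean F)] for arbitrary real phases.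

    For the recursion, write [mean_m] for the mean of the phases other than
    [F_m].  Putting back the omitted wave in the [m]-th factor recovers the full
    sum, up to the rotation by [mean_m]:
    [A_{N,m} + exp (- i (mean_m - F_m)) = S_{N+1} * exp (- i * mean_m)].
    Each phase is omitted exactly once, so it occurs in [N] of the [N+1] means
    and [\sum_m mean_m = \sum_j F_j = (N+1) * mean F].  Hence the product of the
    factors is [S_{N+1}^(N+1) * exp (- i (N+1) mean F)], that is
    [A_{N+1}^(N+1)]. *)

Definition cis (R : realType) (x : R) : R[i] := cos x +i* sin x.

Lemma cexp_i (R : realType) (x : R) : cexp ('i%C * x%:C) = cis x.
Proof.
by rewrite /cexp /= !(mul0r, mul1r, mulr0, add0r, oppr0) expR0 mul1r.
Qed.

Lemma cis0 (R : realType) : cis (0 : R) = 1.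
Proof. by rewrite /cis cos0 sin0. Qed.

Lemma cisD (R : realType) (x y : R) : cis (x + y) = cis x * cis y.
Proof. by rewrite /cis cosD sinD; congr (_ +i* _); rewrite addrC. Qed.

Lemma cis_sum (R : realType) (I : finType) (f : I -> R) :
  cis (\sum_i f i) = \prod_i cis (f i).
Proof. exact: (big_morph _ (@cisD R) (cis0 R)). Qed.

Lemma cisMn (R : realType) (x : R) (n : nat) : cis (x *+ n) = cis x ^+ n.
Proof.
by elim: n => [|n IHn]; rewrite ?cis0 // mulrS exprS cisD IHn.
Qed.

Lemma cisDN (R : realType) (x : R) : cis x + cis (- x) = (2 * cos x)%:C.
Proof.
by rewrite /cis cosN sinN mulr_natl; congr (_ +i* _); rewrite /= subrr.
Qed.

Definition mean (R : realType) (N : nat) (F : 'rV[R]_N) : R :=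
  N%:R^-1 * \sum_(j < N) F 0 j.

Definition amplitude (R : realType) (N : nat) (F : 'rV[R]_N) : R[i] :=
  \sum_(j < N) cis (F 0 j - mean F).

Lemma amplitudeE (R : realType) (N : nat) (F : 'rV[R]_N) :
  amplitude F = (\sum_(j < N) cis (F 0 j)) * cis (- mean F).
Proof. by rewrite mulr_suml; apply: eq_bigr => j _; rewrite cisD. Qed.

Lemma sum_cis_amplitude (R : realType) (N : nat) (F : 'rV[R]_N) :
  \sum_(j < N) cis (F 0 j) = amplitude F * cis (mean F).
Proof. by rewrite amplitudeE -mulrA -cisD addNr cis0 mulr1. Qed.

Lemma sum_col' (R : Type) (V : nmodType) (N : nat) (m : 'I_N.+1)
    (f : R -> V) (F : 'rV[R]_N.+1) :
  \sum_(j < N) f (col' m F 0 j) + f (F 0 m) = \sum_(j < N.+1) f (F 0 j).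
Proof.
rewrite (bigD1_ord m) //= addrC; congr (_ + _).
by apply: eq_bigr => j _; rewrite mxE.
Qed.

(** Omitting each coordinate in turn leaves every coordinate present [N]
    times, which the normalisation [N^-1] of the means cancels. *)
Lemma sum_mean_col' (R : realType) (N : nat) (F : 'rV[R]_N.+1) :
  (0 < N)%N ->
  \sum_(m < N.+1) mean (col' m F) = mean F *+ N.+1.
Proof.
move=> N0; have N0' : N%:R != 0 :> R by rewrite pnatr_eq0 -lt0n.
rewrite -mulr_natl mulVKf ?pnatr_eq0 // -mulr_sumr.
have -> : \sum_(m < N.+1) \sum_(j < N) col' m F 0 j
    = \sum_(m < N.+1) ((\sum_(j < N.+1) F 0 j) - F 0 m).
  by apply: eq_bigr => m _; rewrite -(sum_col' m id) addrK.
rewrite sumrB sumr_const card_ord mulrSr addrK.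
by rewrite -[X in _ * X]mulr_natl mulKf.
Qed.

(** Restoring the omitted wave, rotated by the mean of the others, rebuilds the
    whole sum in that rotated frame. *)
Lemma amplitude_col'D (R : realType) (N : nat) (m : 'I_N.+1)
    (F : 'rV[R]_N.+1) :
  amplitude (col' m F) + cis (F 0 m - mean (col' m F))
    = (\sum_(j < N.+1) cis (F 0 j)) * cis (- mean (col' m F)).
Proof. by rewrite amplitudeE cisD -mulrDl sum_col'. Qed.

Lemma amplitude_exp (R : realType) (N : nat) (F : 'rV[R]_N.+1) :
  (0 < N)%N ->
  amplitude F ^+ N.+1
    = \prod_(m < N.+1)
        (amplitude (col' m F) + cis (F 0 m - mean (col' m F))).
Proof.
move=> N0; under eq_bigr do rewrite amplitude_col'D.
rewrite big_split /= prodr_const card_ord -cis_sum sumrN sum_mean_col' //.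
by rewrite -mulNrn cisMn -exprMn -amplitudeE.
Qed.

Lemma amplitude1 (R : realType) (F : 'rV[R]_1) : amplitude F = 1.
Proof. by rewrite /amplitude /mean !big_ord1 invr1 mul1r subrr cis0. Qed.

Lemma amplitude2 (R : realType) (F : 'rV[R]_2) :
  amplitude F = (2 * cos ((F 0 0 - F 0 1) / 2))%:C.
Proof.
rewrite -cisDN /amplitude /mean !big_ord_recl !big_ord0 !addr0.
have -> : lift ord0 ord0 = 1 :> 'I_2 by apply: val_inj.
by congr (cis _ + cis _); field.
Qed.

(* col' m F is the vector F with its m-th coordinate omitted; the value of A
   at dimension 0 is unconstrained. *)
Theorem theorem7p3 (R : realType) :
  exists A : forall N : nat, 'rV[R]_N -> R[i],
  [/\ forall F : 'rV[R]_1, A 1%N F = 1,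
      forall F : 'rV[R]_2, A 2%N F = (2 * cos ((F 0 0 - F 0 1) / 2))%:C,
      forall (l : int) (N : nat) (u : 'I_N -> int -> R[i]) (F : 'rV[R]_N),
        (1 <= N)%N ->
        (forall j : 'I_N, Gpoly (u j)) ->
        (forall j : 'I_N, u j l = cexp ('i%C * (F 0 j)%:C)) ->
        \sum_(j < N) cexp ('i%C * (F 0 j)%:C)
          = A N F * cexp ('i%C * (N%:R^-1 * \sum_(j < N) F 0 j)%:C)
    & forall (l : int) (N : nat) (u : 'I_N.+1 -> int -> R[i])
        (F : 'rV[R]_N.+1),
        (1 <= N)%N ->
        (forall j : 'I_N.+1, Gpoly (u j)) ->
        (forall j : 'I_N.+1, u j l = cexp ('i%C * (F 0 j)%:C)) ->
        A N.+1 F ^+ N.+1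
          = \prod_(m < N.+1)
              (A N (col' m F)
               + cexp (- 'i%C * ((\sum_(j < N.+1 | j != m) F 0 j
                                - N%:R * F 0 m) / N%:R)%:C))].
Proof.
exists (@amplitude R); split; [exact: amplitude1|exact: amplitude2| |].
  move=> l N u F _ _ _; rewrite cexp_i -sum_cis_amplitude.
  by apply: eq_bigr => j _; rewrite cexp_i.
move=> l N u F N0 _ _; rewrite amplitude_exp //; apply: eq_bigr => m _.
have N0' : N%:R != 0 :> R by rewrite pnatr_eq0 -lt0n.
rewrite mulNr -mulrN -rmorphN cexp_i; congr (_ + cis _).
have -> : \sum_(j < N.+1 | j != m) F 0 j = \sum_(j < N) col' m F 0 j.
  apply: (addIr (F 0 m)); rewrite (sum_col' m id) addrC.
  by rewrite [RHS](bigD1 m).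
by rewrite /mean; field.
Qed.
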